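(* Let $F(z)=\sum_{k=0}^\infty b_k z^k\in\mathcal{B}$. Then \[ \sum_{k=1}^\infty k^2|b_k|^2r^{2k}\le \frac{27}{4}r^4,\qquad \sqrt{4/15}\le r\le\sqrt{1/3}. \] The inequality is sharp: equality holds for $F(z)=\frac{3\sqrt3}{4}z^2$.
   Context: $\mathbb{D}$ denotes the open unit disc. $\mathcal{B}$ is the class of functions $F$ analytic in $\mathbb{D}$ satisfying $|F'(z)|\le \frac{1}{1-|z|^2}$ for all $z\in\mathbb{D}$. For $F\in\mathcal{B}$ we write its Taylor expansion as $F(z)=\sum_{k=0}^\infty b_k z^k$. *)

(* Defs.v *)
From Stdlib Require Import Reals Lra.
Open Scope R_scope.

Definition Cplx : Type := (R * R)%type.
Definition Cre (z : Cplx) : R := fst z.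
Definition Cim (z : Cplx) : R := snd z.
Definition Cadd (z w : Cplx) : Cplx := (fst z + fst w, snd z + snd w).
Definition Cmul (z w : Cplx) : Cplx :=
  (fst z * fst w - snd z * snd w, fst z * snd w + snd z * fst w).
Definition RtoC (x : R) : Cplx := (x, 0).
Definition Cnorm (z : Cplx) : R := sqrt (fst z ^ 2 + snd z ^ 2).

Fixpoint Cpow (z : Cplx) (n : nat) : Cplx :=
  match n with
  | O => (1, 0)
  | S m => Cmul z (Cpow z m)
  end.

Fixpoint Csum (a : nat -> Cplx) (n : nat) : Cplx :=
  match n with
  | O => a O
  | S m => Cadd (Csum a m) (a (S m))
  end.

Definition Cseries_cv (a : nat -> Cplx) (l : Cplx) : Prop :=
  Un_cv (fun n => fst (Csum a n)) (fst l) /\ Un_cv (fun n => snd (Csum a n)) (snd l).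

Definition inD (z : Cplx) : Prop := Cnorm z < 1.

Definition analytic_in_D (b : nat -> Cplx) : Prop :=
  forall z, inD z -> exists l, Cseries_cv (fun k => Cmul (b k) (Cpow z k)) l.

(* F'(z) = sum_{k>=1} k b_k z^{k-1} = sum_k (k+1) b_{k+1} z^k *)
Definition deriv_terms (b : nat -> Cplx) (z : Cplx) (k : nat) : Cplx :=
  Cmul (RtoC (INR (S k))) (Cmul (b (S k)) (Cpow z k)).

Definition in_classB (b : nat -> Cplx) : Prop :=
  analytic_in_D b /\
  forall z, inD z -> exists d, Cseries_cv (deriv_terms b z) d /\
    Cnorm d <= 1 / (1 - Cnorm z ^ 2).

(* k^2 |b_k|^2 r^{2k}, with the k = 0 term vanishing *)
Definition sq_terms (b : nat -> Cplx) (r : R) (k : nat) : R :=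
  INR k ^ 2 * Cnorm (b k) ^ 2 * r ^ (2 * k).

Definition b_extremal (k : nat) : Cplx :=
  match k with
  | 2%nat => RtoC (3 * sqrt 3 / 4)
  | _ => (0, 0)
  end.

(* Main.v *)
Require Import Defs.
From Stdlib Require Import Reals Lra Lia.
From Coquelicot Require Import Coquelicot.
Open Scope C_scope.

(** Write [F' = sum f_k z^k], [A = |f_0|^2], [c = |f_1|^2], [x = r^2].  Parseval on
    [|z| = 1 / sqrt 3] gives [sum |f_k|^2 3^(-k) <= 9/4].  Since [x^k <= 9 x^2 3^(-k)]
    for [k >= 2], the claim follows from this as soon as [c <= 27/4 (1 - A)], the
    slack being [A (1 - 3 x) (15 x / 4 - 1)], nonnegative for [4/15 <= x <= 1/3].

    The bound on [c] is an off-centre Schwarz-Pick inequality for the circle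
    [|(z + a) / (1 + a z)| = 1 / sqrt 3]: if [g] is analytic in the disc, bounded by 1,
    then averaging [conj zeta (1 + beta zeta)^2 g(zeta)] over [|zeta| = 1] gives
    [|g'(0) + 2 beta g(0)| <= 1 + beta^2].  Applied to [g] = the pullback of [F'] to
    that circle times the conformal factor, this yields one linear inequality between
    [|f_0|] and [|f_1|] for every [beta] in [[0, 1)]; the best choice of [beta] is
    [beta (3 - beta^2) / 2 = |f_0|].

    Averages are taken over roots of unity, and [F'] is replaced by its Taylor
    polynomials, which satisfy the growth bound up to [eps] on compact subdiscs. *)

(** * Means over roots of unity *)

(* [Csum] retyped in [C], on which [ring] and [field] act. *)
Definition csum (a : nat -> C) (n : nat) : C := Csum a n.

Lemma csum_S (a : nat -> C) (n : nat) : csum a (S n) = csum a n + a (S n).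
Proof. reflexivity. Qed.

Lemma csum_ext (a b : nat -> C) (n : nat) :
  (forall k, (k <= n)%nat -> a k = b k) -> csum a n = csum b n.
Proof.
induction n as [|n IH]; intros H; [|rewrite !csum_S].
- now apply H.
- rewrite IH by (intros; apply H; lia). now rewrite H.
Qed.

Lemma csum_plus (a b : nat -> C) (n : nat) :
  csum (fun k => a k + b k) n = csum a n + csum b n.
Proof.
induction n as [|n IH]; [reflexivity|]. rewrite !csum_S, IH. ring.
Qed.

Lemma csum_scal (c : C) (a : nat -> C) (n : nat) :
  csum (fun k => c * a k) n = c * csum a n.
Proof.
induction n as [|n IH]; [reflexivity|]. rewrite !csum_S, IH. ring.
Qed.

Lemma csum_const (c : C) (n : nat) : csum (fun _ => c) n = INR (S n) * c.
Proof.
induction n as [|n IH]; [simpl; ring|].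
rewrite csum_S, IH, (S_INR (S n)), RtoC_plus. ring.
Qed.

Lemma csum_conj (a : nat -> C) (n : nat) :
  csum (fun k => Cconj (a k)) n = Cconj (csum a n).
Proof.
induction n as [|n IH]; [reflexivity|]. now rewrite !csum_S, IH, Cplus_conj.
Qed.

(** The majorant is complex valued and enters through its real part, so that in [mean_le] both sides
    are values of [mean] and obey the same algebra. *)
Lemma Cmod_csum_le (a b : nat -> C) (n : nat) :
  (forall k, Cmod (a k) <= Re (b k))%R -> (Cmod (csum a n) <= Re (csum b n))%R.
Proof.
intros H; induction n as [|n IH]; [apply H|].
rewrite !csum_S. eapply Rle_trans; [apply Cmod_triangle|].
specialize (H (S n)). change (Cmod (csum a n) + Cmod (a (S n)) <= Re (csum b n) + Re (b (S n)))%R.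
lra.
Qed.

Lemma geometric_csum (z : C) (n : nat) :
  (1 - z) * csum (fun k => z ^ k) n = 1 - z ^ S n.
Proof.
induction n as [|n IH]; [simpl; ring|].
rewrite csum_S, Cmult_plus_distr_l, IH, (Cpow_S z (S n)). ring.
Qed.

Definition cis (x : R) : C := (cos x, sin x).

Lemma Cmod_cis (x : R) : Cmod (cis x) = 1.
Proof.
unfold Cmod, cis; simpl fst; simpl snd.
rewrite <- sqrt_1. f_equal. generalize (sin2_cos2 x). unfold Rsqr. nra.
Qed.

Lemma cis_pow (x : R) (n : nat) : cis x ^ n = cis (INR n * x).
Proof.
induction n as [|n IH].
- simpl. unfold cis. rewrite Rmult_0_l, cos_0, sin_0. reflexivity.
- rewrite Cpow_S, IH, S_INR, Rmult_plus_distr_r, Rmult_1_l, (Rplus_comm (INR n * x)).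
  unfold cis, Cmult; simpl. now rewrite cos_plus, sin_plus, (Rplus_comm (sin x * _)).
Qed.

Lemma cis_neq_1 (x : R) : (0 < x < 2 * PI)%R -> cis x <> 1.
Proof.
intros Hx E. apply (f_equal fst) in E. simpl in E.
assert (Hs : (0 < sin (x / 2))%R) by (apply sin_gt_0; lra).
replace x with (2 * (x / 2))%R in E by field. rewrite cos_2a_sin in E. nra.
Qed.

(** The order is [n + 1], the number of terms in [csum _ n]. *)
Definition root (n : nat) : C := cis (2 * PI / INR (S n)).

Lemma INR_S_pos (n : nat) : (0 < INR (S n))%R.
Proof. apply lt_0_INR; lia. Qed.

Lemma INR_S_neq_0 (n : nat) : RtoC (INR (S n)) <> 0.
Proof. intros E. apply RtoC_inj in E. generalize (INR_S_pos n). lra. Qed.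

Lemma Cmod_root_pow (n j : nat) : Cmod (root n ^ j) = 1.
Proof. unfold root. now rewrite Cmod_pow, Cmod_cis, pow1. Qed.

Lemma root_pow_order (n : nat) : root n ^ S n = 1.
Proof.
unfold root. rewrite cis_pow.
replace (INR (S n) * (2 * PI / INR (S n)))%R with (2 * PI)%R
  by (field; generalize (INR_S_pos n); lra).
unfold cis. now rewrite cos_2PI, sin_2PI.
Qed.

Lemma root_pow_neq_1 (n i : nat) : (1 <= i <= n)%nat -> root n ^ i <> 1.
Proof.
intros Hi. unfold root. rewrite cis_pow. apply cis_neq_1.
assert (H1 : (0 < INR i)%R) by (apply lt_0_INR; lia).
assert (H2 : (INR i < INR (S n))%R) by (apply lt_INR; lia).
generalize PI_RGT_0; intros HPI. assert (H3 := INR_S_pos n).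
replace (INR i * (2 * PI / INR (S n)))%R with (INR i / INR (S n) * (2 * PI))%R by (field; lra).
assert (0 < INR i / INR (S n))%R by (apply Rdiv_lt_0_compat; lra).
assert (INR i / INR (S n) < 1)%R by (apply Rlt_div_l; lra).
nra.
Qed.

Definition mean (n : nat) (g : C -> C) : C :=
  csum (fun j => g (root n ^ j)) n / INR (S n).

Lemma mean_ext (n : nat) (g h : C -> C) :
  (forall z, Cmod z = 1%R -> g z = h z) -> mean n g = mean n h.
Proof.
intros H. unfold mean. f_equal. apply csum_ext. intros; apply H, Cmod_root_pow.
Qed.

Lemma mean_plus (n : nat) (g h : C -> C) :
  mean n (fun z => g z + h z) = mean n g + mean n h.
Proof. unfold mean. rewrite csum_plus. field. apply INR_S_neq_0. Qed.

Lemma mean_scal (n : nat) (c : C) (g : C -> C) :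
  mean n (fun z => c * g z) = c * mean n g.
Proof. unfold mean. rewrite csum_scal. field. apply INR_S_neq_0. Qed.

Lemma mean_const (n : nat) (c : C) : mean n (fun _ => c) = c.
Proof. unfold mean. rewrite csum_const. field. apply INR_S_neq_0. Qed.

Lemma mean_conj (n : nat) (g : C -> C) :
  mean n (fun z => Cconj (g z)) = Cconj (mean n g).
Proof.
unfold mean. rewrite csum_conj, Cdiv_conj by apply INR_S_neq_0.
f_equal. unfold Cconj, RtoC; simpl. now rewrite Ropp_0.
Qed.

Lemma mean_le (n : nat) (g h : C -> C) :
  (forall z, Cmod z = 1%R -> (Cmod (g z) <= Re (h z))%R) ->
  (Cmod (mean n g) <= Re (mean n h))%R.
Proof.
intros H. unfold mean, Cdiv. assert (Hn := INR_S_pos n).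
assert (Hi : (0 < / INR (S n))%R) by now apply Rinv_0_lt_compat.
rewrite <- RtoC_inv, Cmod_mult, re_scal_r, Cmod_R, Rabs_pos_eq by lra.
apply Rmult_le_compat_r; [lra|]. apply Cmod_csum_le.
intros; apply H, Cmod_root_pow.
Qed.

(** The sum is geometric with ratio [w = root n ^ i], where [w ^ (n + 1) = 1] and [w <> 1]. *)
Lemma mean_pow (n i : nat) : (1 <= i <= n)%nat -> mean n (fun z => z ^ i) = 0.
Proof.
intros Hi. unfold mean.
rewrite (csum_ext _ (fun j => (root n ^ i) ^ j)) by
  (intros k _; now rewrite <- !Cpow_mult_r, Nat.mul_comm).
assert (H := geometric_csum (root n ^ i) n).
rewrite <- Cpow_mult_r, Nat.mul_comm, Cpow_mult_r, root_pow_order, Cpow_1_l in H.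
assert (Hne : 1 - root n ^ i <> 0)
  by (apply Cminus_eq_contra; intros E; now apply (root_pow_neq_1 n i)).
assert (E : (csum (fun j => (root n ^ i) ^ j) n : C) = 0).
{ transitivity ((1 - root n ^ i) * csum (fun j => (root n ^ i) ^ j) n / (1 - root n ^ i)).
  - field. exact Hne.
  - rewrite H. field. exact Hne. }
rewrite E. field. apply INR_S_neq_0.
Qed.

(** * Boundary values of analytic functions *)

(* Replaces analyticity in the disc: all that is needed of it is that the means of
   [z^i g], [i >= 1], tend to 0, uniformly as long as [i] does not wrap around
   modulo the number [n + 1] of roots of unity. *)
Definition circle_analytic (g : C -> C) : Prop :=
  (exists B : R, forall z, Cmod z = 1%R -> (Cmod (g z) <= B)%R) /\
  forall eps : R, (0 < eps)%R -> exists m : nat, forall n i : nat,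
    (1 <= i)%nat -> (i + m <= n)%nat -> (Cmod (mean n (fun z => z ^ i * g z)%C) <= eps)%R.

Lemma circle_analytic_const (c : C) : circle_analytic (fun _ => c).
Proof.
split.
- exists (Cmod c). intros; lra.
- intros eps He. exists 0%nat. intros n i Hi Hn.
  rewrite (mean_ext _ _ (fun z => c * z ^ i)) by (intros; ring).
  rewrite mean_scal, mean_pow, Cmult_0_r, Cmod_0 by lia. lra.
Qed.

Lemma circle_analytic_plus (g h : C -> C) :
  circle_analytic g -> circle_analytic h -> circle_analytic (fun z => g z + h z).
Proof.
intros [[B HB] Hg] [[B' HB'] Hh]. split.
- exists (B + B')%R. intros z Hz. eapply Rle_trans; [apply Cmod_triangle|].
  specialize (HB z Hz); specialize (HB' z Hz); lra.
- intros eps He. destruct (Hg (eps / 2)%R) as [m Hm]; [lra|].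
  destruct (Hh (eps / 2)%R) as [m' Hm']; [lra|].
  exists (m + m')%nat. intros n i Hi Hn.
  rewrite (mean_ext _ _ (fun z => z ^ i * g z + z ^ i * h z)) by (intros; ring).
  rewrite mean_plus. eapply Rle_trans; [apply Cmod_triangle|].
  specialize (Hm n i Hi ltac:(lia)); specialize (Hm' n i Hi ltac:(lia)); lra.
Qed.

Lemma circle_analytic_scal (c : C) (g : C -> C) :
  circle_analytic g -> circle_analytic (fun z => c * g z).
Proof.
intros [[B HB] Hg]. assert (Hc := Cmod_ge_0 c). split.
- exists (Cmod c * B)%R. intros z Hz. rewrite Cmod_mult.
  apply Rmult_le_compat_l; auto.
- intros eps He. destruct (Hg (eps / (1 + Cmod c))%R) as [m Hm];
    [apply Rdiv_lt_0_compat; lra|].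
  exists m. intros n i Hi Hn.
  rewrite (mean_ext _ _ (fun z => c * (z ^ i * g z))) by (intros; ring).
  rewrite mean_scal, Cmod_mult. specialize (Hm n i Hi Hn).
  apply Rle_trans with (Cmod c * (eps / (1 + Cmod c)))%R;
    [now apply Rmult_le_compat_l|].
  replace (Cmod c * (eps / (1 + Cmod c)))%R with (eps * Cmod c / (1 + Cmod c))%R by (field; lra).
  apply Rle_div_l; nra.
Qed.

Lemma circle_analytic_shift (g : C -> C) :
  circle_analytic g -> circle_analytic (fun z => z * g z).
Proof.
intros [[B HB] Hg]. split.
- exists B. intros z Hz. rewrite Cmod_mult, Hz, Rmult_1_l. auto.
- intros eps He. destruct (Hg eps He) as [m Hm]. exists (S m). intros n i Hi Hn.
  rewrite (mean_ext _ _ (fun z => z ^ S i * g z)) by (intros; rewrite Cpow_S; ring).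
  apply Hm; lia.
Qed.

Lemma Cmod_1_plus_ge (t : R) (z : C) :
  (0 <= t)%R -> Cmod z = 1%R -> (1 - t <= Cmod (1 + t * z)%C)%R.
Proof.
intros Ht Hz. assert (H := Cmod_triangle (1 + t * z) (- (t * z))).
replace (1 + t * z + - (t * z)) with (RtoC 1) in H by ring.
rewrite Cmod_1, Cmod_opp, Cmod_mult, Hz, Cmod_R, Rabs_pos_eq in H by assumption. lra.
Qed.

Lemma Cone_plus_neq_0 (t : R) (z : C) :
  (0 <= t < 1)%R -> Cmod z = 1%R -> 1 + t * z <> 0.
Proof.
intros Ht Hz E. assert (H := Cmod_1_plus_ge t z (proj1 Ht) Hz).
rewrite E, Cmod_0 in H. lra.
Qed.

Lemma circle_analytic_div (t : R) (g : C -> C) :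
  (0 <= t < 1)%R -> circle_analytic g -> circle_analytic (fun z => g z / (1 + t * z)).
Proof.
intros Ht [[B HB] Hg].
assert (Hb : forall z, Cmod z = 1%R -> (Cmod (g z / (1 + t * z))%C <= B / (1 - t))%R).
{ intros z Hz. assert (Hge := Cmod_1_plus_ge t z (proj1 Ht) Hz).
  rewrite Cmod_div by now apply Cone_plus_neq_0.
  specialize (HB z Hz). assert (H0 := Cmod_ge_0 (g z)).
  apply Rmult_le_compat; try lra.
  - apply Rlt_le, Rinv_0_lt_compat; lra.
  - apply Rinv_le_contravar; lra. }
split; [now exists (B / (1 - t))%R|].
assert (HB0 : (0 <= B)%R).
{ eapply Rle_trans; [apply Cmod_ge_0|]. apply (HB 1), Cmod_1. }
(* [h = g / (1 + t z)] satisfies [h = g - t z h]; iterate this [J] times. *)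
assert (Hiter : forall (J : nat) (eps : R), (0 < eps)%R -> exists m, forall n i : nat,
  (1 <= i)%nat -> (i + m <= n)%nat ->
  (Cmod (mean n (fun z => z ^ i * (g z / (1 + t * z)))%C) <=
   eps + t ^ J * (B / (1 - t)))%R).
{ induction J as [|J IH]; intros eps He.
  - exists 0%nat. intros n i Hi Hn.
    assert (Hle := mean_le n (fun z => z ^ i * (g z / (1 + t * z)))
      (fun _ => RtoC (B / (1 - t)))).
    rewrite mean_const, re_RtoC in Hle. simpl pow.
    eapply Rle_trans; [apply Hle|lra].
    intros z Hz. rewrite Cmod_mult, Cmod_pow, Hz, pow1, Rmult_1_l. now apply Hb.
  - destruct (IH (eps / 2)%R) as [m Hm]; [lra|].
    destruct (Hg (eps / 2)%R) as [m' Hm']; [lra|].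
    exists (S (m + m')). intros n i Hi Hn.
    (* The remainder is the same mean with exponent [S i] and an extra factor [t]; the raised
       exponent is paid for by the successor in the threshold. *)
    rewrite (mean_ext _ _ (fun z => z ^ i * g z + (- t) * (z ^ S i * (g z / (1 + t * z))))).
    2:{ intros z Hz. rewrite Cpow_S. field. now apply Cone_plus_neq_0. }
    rewrite mean_plus, mean_scal. eapply Rle_trans; [apply Cmod_triangle|].
    rewrite Cmod_mult, Cmod_opp, Cmod_R, Rabs_pos_eq by lra.
    specialize (Hm' n i Hi ltac:(lia)). specialize (Hm n (S i) ltac:(lia) ltac:(lia)).
    simpl pow in *. set (M := Cmod (mean n (fun z => z ^ S i * _)%C)) in *.
    nra. }
intros eps He.
assert (Hpow : exists J, (t ^ J * (B / (1 - t)) <= eps / 2)%R).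
(* The [1 +] keeps the denominator positive when [B = 0]. *)
{ destruct (pow_lt_1_zero t) with (y := (eps / 2 / (1 + B / (1 - t)))%R) as [J HJ].
  - rewrite Rabs_pos_eq; lra.
  - assert (0 <= B / (1 - t))%R by (apply Rdiv_le_0_compat; lra).
    apply Rdiv_lt_0_compat; lra.
  - exists J. specialize (HJ J (le_n J)).
    assert (HBt : (0 <= B / (1 - t))%R) by (apply Rdiv_le_0_compat; lra).
    rewrite Rabs_pos_eq in HJ by (apply pow_le; lra).
    set (X := (B / (1 - t))%R) in *.
    apply Rlt_div_r in HJ; [|lra]. assert (0 <= t ^ J)%R by (apply pow_le; lra). nra. }
destruct Hpow as [J HJ]. destruct (Hiter J (eps / 2)%R) as [m Hm]; [lra|].
exists m. intros n i Hi Hn. specialize (Hm n i Hi Hn). lra.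
Qed.

(** * Two-term Taylor jets of boundary functions *)

(** Here [v] and [d] stand for the value and the derivative at 0 of the analytic extension of [g],
    read off from boundary values alone. *)
Definition circle_jet (g : C -> C) (v d : C) : Prop :=
  exists h, circle_analytic h /\
    forall z, Cmod z = 1%R -> g z = v + d * z + z * (z * h z).

Lemma circle_jet_const (c : C) : circle_jet (fun _ => c) c 0.
Proof.
exists (fun _ => 0). split; [apply circle_analytic_const|]. intros; ring.
Qed.

Lemma circle_jet_plus (g h : C -> C) (v d v' d' : C) :
  circle_jet g v d -> circle_jet h v' d' ->
  circle_jet (fun z => g z + h z) (v + v') (d + d').
Proof.
intros [r [Hr Eg]] [s [Hs Eh]]. exists (fun z => r z + s z).
split; [now apply circle_analytic_plus|].
intros z Hz. rewrite Eg, Eh by assumption. ring.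
Qed.

Lemma circle_jet_scal (c : C) (g : C -> C) (v d : C) :
  circle_jet g v d -> circle_jet (fun z => c * g z) (c * v) (c * d).
Proof.
intros [r [Hr Eg]]. exists (fun z => c * r z).
split; [now apply circle_analytic_scal|].
intros z Hz. rewrite Eg by assumption. ring.
Qed.

Lemma circle_jet_shift (g : C -> C) (v d : C) :
  circle_jet g v d -> circle_jet (fun z => z * g z) 0 v.
Proof.
intros [r [Hr Eg]]. exists (fun z => d + z * r z).
split.
- apply circle_analytic_plus; [apply circle_analytic_const|].
  now apply circle_analytic_shift.
- intros z Hz. rewrite Eg by assumption. ring.
Qed.

Lemma circle_jet_div (t : R) (g : C -> C) (v d : C) :
  (0 <= t < 1)%R -> circle_jet g v d ->
  circle_jet (fun z => g z / (1 + t * z)) v (d - t * v).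
Proof.
(* The constant corrects for [(v + (d - t v) z) (1 + t z) = v + d z + (t d - t^2 v) z^2]. *)
intros Ht [r [Hr Eg]]. exists (fun z => (r z + (t * t * v - t * d)) / (1 + t * z)).
split.
- apply (circle_analytic_div t (fun z => r z + (t * t * v - t * d)) Ht).
  apply circle_analytic_plus; [assumption|apply circle_analytic_const].
- intros z Hz. rewrite Eg by assumption. field. now apply Cone_plus_neq_0.
Qed.

Lemma circle_jet_ext (g h : C -> C) (v d v' d' : C) :
  circle_jet g v d -> (forall z, Cmod z = 1%R -> h z = g z) -> v' = v -> d' = d ->
  circle_jet h v' d'.
Proof.
intros [r [Hr Eg]] E -> ->. exists r. split; [assumption|].
intros z Hz. rewrite E by assumption. now apply Eg.
Qed.

Lemma Cmult_conj_circle (z : C) : Cmod z = 1%R -> Cconj z * z = 1.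
Proof.
intros Hz. rewrite Cmult_comm, <- Cmod2_conj, Hz. f_equal. ring.
Qed.

(** On the circle [Cconj z] is [1 / z], so [d] becomes the constant term of
    [v * Cconj z + d + z * h z]; the first mean vanishes exactly and the last becomes small. *)
Lemma circle_jet_mean (g : C -> C) (v d : C) (eps : R) :
  circle_jet g v d -> (0 < eps)%R -> exists m : nat, forall n : nat, (m <= n)%nat ->
    (Cmod (mean n (fun z => Cconj z * g z) - d)%C <= eps)%R.
Proof.
intros [r [[_ Hr] Eg]] He. destruct (Hr eps He) as [m Hm].
exists (S m). intros n Hn.
rewrite (mean_ext _ _ (fun z => (v * Cconj (z ^ 1) + d) + z ^ 1 * r z)).
- rewrite !mean_plus, mean_scal, mean_const, mean_conj, mean_pow by lia.
  replace (v * Cconj 0 + d + mean n (fun z => z ^ 1 * r z) - d)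
    with (mean n (fun z => z ^ 1 * r z)).
  + apply Hm; lia.
  + replace (Cconj 0) with (RtoC 0); [ring|].
    unfold Cconj, RtoC; simpl; now rewrite Ropp_0.
- intros z Hz. rewrite Eg by assumption. rewrite !Cpow_1_r.
  transitivity (v * Cconj z + (Cconj z * z) * d + (Cconj z * z) * (z * r z)); [ring|].
  rewrite Cmult_conj_circle by assumption. ring.
Qed.

Lemma circle_jet_mult_1_plus (t : R) (g : C -> C) (v d : C) :
  circle_jet g v d -> circle_jet (fun z => (1 + t * z) * g z) v (d + t * v).
Proof.
intros Hg.
apply (circle_jet_ext _ _ _ _ _ _
  (circle_jet_plus _ _ _ _ _ _ Hg (circle_jet_scal t _ _ _ (circle_jet_shift _ _ _ Hg))));
  intros; ring.
Qed.

Definition psum (f : nat -> C) (n : nat) (z : C) : C := csum (fun k => f k * z ^ k) n.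

Lemma psum_S (f : nat -> C) (n : nat) (z : C) :
  psum f (S n) z = psum f n z + f (S n) * z ^ S n.
Proof. reflexivity. Qed.

(** The inner map fixes 0 and has derivative [s] there, so its powers from the second on leave the
    jet unchanged. The index [S n] ensures that [f 1] is present. *)
Lemma circle_jet_psum (f : nat -> C) (s t : R) (W : C -> C) (v d : C) (n : nat) :
  (0 <= t < 1)%R -> circle_jet W v d ->
  circle_jet (fun z => psum f (S n) (s * (z / (1 + t * z))) * W z)
    (f O * v) (f O * d + f 1%nat * (s * v)).
Proof.
intros Ht HW.
assert (Hstep : forall g v' d', circle_jet g v' d' ->
  circle_jet (fun z => s * (z / (1 + t * z)) * g z) 0 (s * v')).
{ intros g v' d' Hg.
  apply (circle_jet_ext _ _ _ _ _ _
    (circle_jet_scal s _ _ _ (circle_jet_div t _ _ _ Ht (circle_jet_shift _ _ _ Hg))));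
    [|ring|ring].
  intros z Hz. field. now apply Cone_plus_neq_0. }
assert (Hpow : forall k, circle_jet (fun z => (s * (z / (1 + t * z))) ^ S (S k) * W z) 0 0).
{ induction k as [|k IH].
  - apply (circle_jet_ext _ _ _ _ _ _ (Hstep _ _ _ (Hstep _ _ _ HW)));
      [intros; simpl; ring|ring|ring].
  - apply (circle_jet_ext _ _ _ _ _ _ (Hstep _ _ _ IH));
      [intros; rewrite (Cpow_S _ (S (S k))); ring|ring|ring]. }
induction n as [|n IH].
- apply (circle_jet_ext _ _ _ _ _ _ (circle_jet_plus _ _ _ _ _ _
    (circle_jet_scal (f O) _ _ _ HW) (circle_jet_scal (f 1%nat) _ _ _ (Hstep _ _ _ HW))));
    [|ring|ring].
  intros; unfold psum, csum; simpl.
  change Cadd with Cplus. ring.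
- apply (circle_jet_ext _ _ _ _ _ _ (circle_jet_plus _ _ _ _ _ _ IH
    (circle_jet_scal (f (S (S n))) _ _ _ (Hpow n)))); [|ring|ring].
  intros; rewrite (psum_S _ (S n)). ring.
Qed.

Lemma Cmod_1_plus_sq (t : R) (z : C) :
  Cmod z = 1%R -> (Cmod (1 + t * z)%C ^ 2 = 1 + t ^ 2 + 2 * t * Re z)%R.
Proof.
intros Hz. assert (H := Cmod2_alt z). rewrite Hz in H. rewrite Cmod2_alt.
destruct z as [x y]. simpl in *. nra.
Qed.

(** The averages of [Cconj z (1 + beta z)^2 G z] tend to [d], and their integrands are bounded by
    [K |1 + beta z|^2], whose mean is [K (1 + beta^2)]. *)
Lemma circle_jet_bound (beta K : R) (G : C -> C) (v d : C) :
  (forall z, Cmod z = 1%R -> (Cmod (G z) <= K)%R) ->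
  circle_jet (fun z => (1 + beta * z) * ((1 + beta * z) * G z)) v d ->
  (Cmod d <= K * (1 + beta ^ 2))%R.
Proof.
intros HG Hjet. apply le_epsilon; intros eps He.
destruct (circle_jet_mean _ _ _ eps Hjet He) as [m Hm].
specialize (Hm (S m) ltac:(lia)).
set (g := fun z => Cconj z * ((1 + beta * z) * ((1 + beta * z) * G z))) in *.
(* The majorant has real part [K |1 + beta z|^2] on the circle and is a polynomial in [z], so
   [mean_pow] gives its mean. *)
assert (Hle := mean_le (S m) g
  (fun z => RtoC (K * (1 + beta ^ 2)) + RtoC (2 * K * beta) * z ^ 1)).
rewrite mean_plus, mean_scal, mean_const, mean_pow, Cmult_0_r, Cplus_0_r, re_RtoC in Hle by lia.
assert (H1 : (Cmod (mean (S m) g) <= K * (1 + beta ^ 2))%R).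
{ apply Hle. intros z Hz. unfold g.
  rewrite !Cmod_mult, Cmod_conj, Hz, Rmult_1_l.
  rewrite Cpow_1_r.
  replace (Re (RtoC (K * (1 + beta ^ 2)) + RtoC (2 * K * beta) * z))%R
    with (K * (1 + beta ^ 2 + 2 * beta * Re z))%R
    by (change (K * (1 + beta ^ 2 + 2 * beta * Re z) =
                K * (1 + beta ^ 2) + Re (RtoC (2 * K * beta) * z)%C)%R;
        rewrite re_scal_l; ring).
  rewrite <- Cmod_1_plus_sq by assumption.
  specialize (HG z Hz). assert (0 <= Cmod (1 + beta * z)%C ^ 2)%R by apply pow2_ge_0. nra. }
assert (H2 := Cmod_triangle (mean (S m) g) (- (mean (S m) g - d))).
replace (mean (S m) g + - (mean (S m) g - d)) with d in H2 by ring.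
rewrite Cmod_opp in H2. lra.
Qed.

(** * The bound on the second coefficient *)

(* For [f k = (k + 1) b_(k+1)], the sequence [psum f] consists of the Taylor
    polynomials of [F']. *)
Definition bloch_coeffs (f : nat -> C) : Prop :=
  forall rho eps : R, (rho < 1)%R -> (0 < eps)%R ->
  exists N : nat, forall n : nat, (N <= n)%nat -> forall z : C, (Cmod z <= rho)%R ->
    (Cmod (psum f n z) * (1 - Cmod z ^ 2) <= 1 + eps)%R.

Lemma sqrt3_sq : (sqrt 3 * sqrt 3 = 3)%R.
Proof. apply sqrt_sqrt; lra. Qed.

Lemma sqrt3_bounds : (1.7 < sqrt 3 < 2)%R.
Proof. assert (H := sqrt3_sq). assert (H' := sqrt_pos 3). split; nra. Qed.

(* With [a = beta / sqrt 3], the circle [|(z + a) / (1 + a z)| = 1 / sqrt 3], on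
   which [|F'| (1 - |z|^2)] attains its bound 1 for the extremal function, is
   parametrized by [z = s zeta / (1 + t zeta)], [|zeta| = 1]; there
   [1 - |z|^2 = (2 / (3 - beta^2)) |1 + beta zeta|^2 / |1 + t zeta|^2]. *)
Lemma bloch_coeffs_linear (f : nat -> C) (beta : R) :
  bloch_coeffs f -> (0 <= beta < 1)%R ->
  (Cmod (RtoC (sqrt 3 * (1 - beta ^ 2)) * f 1%nat +
         RtoC (4 * beta * (2 - beta ^ 2)) * f O)%C
   <= (1 + beta ^ 2) * (3 - beta ^ 2) ^ 2 / 2)%R.
Proof.
intros Hf Hb. assert (H3 := sqrt3_sq). assert (H3' := sqrt3_bounds).
assert (Hb2 : (0 <= beta ^ 2 < 1)%R) by nra.
set (q := (3 - beta ^ 2)%R) in *. assert (Hq : (2 < q <= 3)%R) by (unfold q; lra).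
set (t := (2 * beta / q)%R). set (s := (sqrt 3 * (1 - beta ^ 2) / q)%R).
assert (Htq : (t * q = 2 * beta)%R) by (unfold t; field; lra).
assert (Hsq : (s * q = sqrt 3 * (1 - beta ^ 2))%R) by (unfold s; field; lra).
assert (Ht : (0 <= t < 1)%R) by (unfold q in *; split; nra).
assert (Hs : (0 < s)%R) by nra.
(* The largest modulus on the circle parametrized by [s w / (1 + t w)], attained at [w = -1]. *)
set (rho := (s / (1 - t))%R).
assert (Hrho : (rho < 1)%R).
{ unfold rho. apply Rlt_div_l; [lra|]. rewrite Rmult_1_l.
  apply Rmult_lt_reg_r with q; [lra|]. rewrite Rmult_minus_distr_r, Htq, Hsq. unfold q.
  (* This product is [q (1 - t) - q s], because [q - 2 beta = (1 - beta) (3 + beta)]. *)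
  assert (0 < (1 - beta) * (3 + beta - sqrt 3 * (1 + beta)))%R by (apply Rmult_lt_0_compat; nra).
  lra. }
apply Rmult_le_reg_l with (2 / q ^ 2)%R.
{ apply Rdiv_lt_0_compat; [lra|]. apply pow_lt; lra. }
replace (2 / q ^ 2 * ((1 + beta ^ 2) * q ^ 2 / 2))%R with (1 + beta ^ 2)%R by (field; lra).
apply le_epsilon; intros eps He.
destruct (Hf rho (eps / 2)%R Hrho) as [N HN]; [lra|].
specialize (HN (S N) ltac:(lia)).
set (zeta := fun w : C => s * (w / (1 + t * w))) in *.
(* The second factor is analytic and has modulus [1 - |zeta w|^2] on the unit circle, so the growth
   bound becomes a bound on [G]. *)
set (G := fun w : C =>
  psum f (S N) (zeta w) * (RtoC (2 / q) * ((1 + beta * w) * (1 + beta * w)) /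
  ((1 + t * w) * (1 + t * w)))).
assert (HG : forall w, Cmod w = 1%R -> (Cmod (G w) <= 1 + eps / 2)%R).
{ intros w Hw. assert (Hne := Cone_plus_neq_0 t w Ht Hw).
  assert (Hge := Cmod_1_plus_ge t w (proj1 Ht) Hw).
  assert (Hz : Cmod (zeta w) = (s / Cmod (1 + t * w)%C)%R).
  { unfold zeta. rewrite Cmod_mult, Cmod_div, Hw, Cmod_R, Rabs_pos_eq by (assumption || lra).
    field. lra. }
  assert (Hzr : (Cmod (zeta w) <= rho)%R).
  { rewrite Hz. unfold rho. apply Rmult_le_compat_l; [lra|].
    apply Rinv_le_contravar; lra. }
  specialize (HN _ Hzr). eapply Rle_trans; [|exact HN]. right.
  unfold G. rewrite Cmod_mult. f_equal.
  rewrite Cmod_div, !Cmod_mult, Cmod_R by now apply Cmult_neq_0.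
  rewrite Rabs_pos_eq by (apply Rlt_le, Rdiv_lt_0_compat; lra).
  rewrite Hz.
  assert (E1 := Cmod_1_plus_sq t w Hw). assert (E2 := Cmod_1_plus_sq beta w Hw).
  set (A := Cmod (1 + t * w)%C) in *. set (B := Cmod (1 + beta * w)%C) in *.
  replace (2 / q * (B * B) / (A * A))%R with (2 * B ^ 2 * q / (q ^ 2 * A ^ 2))%R
    by (field; split; lra).
  replace (1 - (s / A) ^ 2)%R with ((q ^ 2 * A ^ 2 - (s * q) ^ 2) / (q ^ 2 * A ^ 2))%R
    by (field; split; lra).
  f_equal.
  rewrite E1, E2, Hsq.
  replace (q ^ 2 * (1 + t ^ 2 + 2 * t * Re w))%R
    with (q ^ 2 + (t * q) ^ 2 + 2 * (t * q) * q * Re w)%R by ring.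
  rewrite Htq.
  replace ((sqrt 3 * (1 - beta ^ 2)) ^ 2)%R with (3 * (1 - beta ^ 2) ^ 2)%R
    by (transitivity (sqrt 3 * sqrt 3 * (1 - beta ^ 2) ^ 2)%R; [rewrite H3; ring|ring]).
  (* With [u = beta^2] the constant terms match by [(3 - u)^2 + 4 u - 3 (1 - u)^2 = 2 (3 - u) (1 +
     u)]. *)
  unfold q. ring. }
(* The weight is [(2 / q) (1 + beta w)^4 / (1 + t w)^2]: two factors [1 + beta w] come from [G] and
   two from [circle_jet_bound]. Its logarithmic derivative at 0 is [4 beta - 2 t]. *)
assert (HW := circle_jet_scal (RtoC (2 / q)) _ _ _
  (circle_jet_div t _ _ _ Ht (circle_jet_div t _ _ _ Ht
  (circle_jet_mult_1_plus beta _ _ _ (circle_jet_mult_1_plus beta _ _ _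
  (circle_jet_mult_1_plus beta _ _ _ (circle_jet_mult_1_plus beta _ _ _
    (circle_jet_const 1)))))))).
assert (HJ := circle_jet_psum f s t _ _ _ N Ht HW). clear HW.
assert (Hd : (Cmod (RtoC (2 / q) * (RtoC s * f 1%nat + RtoC (4 * beta - 2 * t) * f O))%C
  <= (1 + eps / 2) * (1 + beta ^ 2))%R).
{ apply (circle_jet_bound beta _ G (f O * RtoC (2 / q)) _ HG).
  apply (circle_jet_ext _ _ _ _ _ _ HJ).
  - intros w Hw. unfold G, zeta. field. now apply Cone_plus_neq_0.
  - ring.
  - rewrite RtoC_minus, !RtoC_mult. ring. }
replace (RtoC (2 / q) * (RtoC s * f 1%nat + RtoC (4 * beta - 2 * t) * f O))
  with (RtoC (2 / q ^ 2) * (RtoC (sqrt 3 * (1 - beta ^ 2)) * f 1%nat +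
         RtoC (4 * beta * (2 - beta ^ 2)) * f O)) in Hd.
- rewrite Cmod_mult, Cmod_R, Rabs_pos_eq in Hd.
  + nra.
  + apply Rlt_le, Rdiv_lt_0_compat; [lra|]. apply pow_lt; lra.
- rewrite <- Hsq.
  replace (4 * beta * (2 - beta ^ 2))%R with ((4 * beta - 2 * t) * q)%R.
  + replace (2 / q)%R with (2 / q ^ 2 * q)%R by (field; lra).
    rewrite !RtoC_mult. ring.
  + replace ((4 * beta - 2 * t) * q)%R with (4 * beta * q - 2 * (t * q))%R by ring.
    rewrite Htq. unfold q. ring.
Qed.

Lemma psum_rotate (f : nat -> C) (u v z : C) (n : nat) :
  psum (fun k => u * (v ^ k * f k)) n z = u * psum f n (v * z).
Proof.
unfold psum. rewrite <- csum_scal. apply csum_ext. intros k _.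
rewrite Cpow_mult_l. ring.
Qed.

(** Passing to [u F'(v z)] multiplies [f 0] by [u] and [f 1] by [u v], so both phases can be
    prescribed independently. *)
Lemma bloch_coeffs_rotate (f : nat -> C) (u v : C) :
  bloch_coeffs f -> Cmod u = 1%R -> Cmod v = 1%R ->
  bloch_coeffs (fun k => u * (v ^ k * f k)).
Proof.
intros Hf Hu Hv rho eps Hr He. destruct (Hf rho eps Hr He) as [N HN].
exists N. intros n Hn z Hz.
rewrite psum_rotate, Cmod_mult, Hu, Rmult_1_l.
assert (E : Cmod (v * z) = Cmod z) by (rewrite Cmod_mult, Hv; ring).
rewrite <- E. apply HN; [assumption|]. now rewrite E.
Qed.

Lemma exists_unit_phase (w : C) : exists u, Cmod u = 1%R /\ u * w = Cmod w.
Proof.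
destruct (Ceq_dec w 0) as [->|Hw].
- exists 1. rewrite Cmod_1, Cmod_0. split; [reflexivity|ring].
- assert (Hm : (0 < Cmod w)%R) by now apply Cmod_gt_0.
  assert (Hm' : RtoC (Cmod w) <> 0) by (intros E; apply RtoC_inj in E; lra).
  exists (Cconj w / Cmod w). split.
  + rewrite Cmod_div, Cmod_conj, Cmod_R, Rabs_pos_eq by (assumption || lra). field. lra.
  + transitivity (w * Cconj w / Cmod w); [field; exact Hm'|].
    rewrite <- Cmod2_conj. rewrite RtoC_pow. simpl. field. exact Hm'.
Qed.

(** After a rotation making [f 0] and [f 1] real and nonnegative, the modulus in
    [bloch_coeffs_linear] is the sum of the two moduli. *)
Lemma bloch_coeffs_linear_norm (f : nat -> C) (beta : R) :
  bloch_coeffs f -> (0 <= beta < 1)%R ->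
  (sqrt 3 * (1 - beta ^ 2) * Cmod (f 1%nat) + 4 * beta * (2 - beta ^ 2) * Cmod (f O)
   <= (1 + beta ^ 2) * (3 - beta ^ 2) ^ 2 / 2)%R.
Proof.
intros Hf Hb.
destruct (exists_unit_phase (f O)) as [u [Hu Eu]].
destruct (exists_unit_phase (u * f 1%nat)) as [v [Hv Ev]].
assert (H := bloch_coeffs_linear _ beta (bloch_coeffs_rotate f u v Hf Hu Hv) Hb).
simpl in H. rewrite Cmult_1_r, Cmult_1_l, Eu in H.
replace (u * (v * f 1%nat)) with (RtoC (Cmod (f 1%nat))) in H.
2:{ transitivity (v * (u * f 1%nat)); [|ring]. now rewrite Ev, Cmod_mult, Hu, Rmult_1_l. }
rewrite <- !RtoC_mult, <- RtoC_plus, Cmod_R in H.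
eapply Rle_trans; [|exact H].
rewrite !Rmult_1_r. change (beta ^ 2)%R with (beta * (beta * 1))%R. rewrite !Rmult_1_r.
apply Rle_abs.
Qed.

Lemma bloch_coeffs_0 (f : nat -> C) : bloch_coeffs f -> (Cmod (f O) <= 1)%R.
Proof.
intros Hf. apply le_epsilon; intros eps He.
destruct (Hf 0%R eps) as [N HN]; [lra|lra|].
specialize (HN N (le_n N) 0). rewrite Cmod_0 in HN. specialize (HN (Rle_refl 0)).
replace (psum f N 0) with (f O) in HN; [lra|].
clear HN. induction N as [|N IH].
- unfold psum, csum; simpl. change (f O = Cmult (f O) 1). ring.
- rewrite psum_S, <- IH, Cpow_S. ring.
Qed.

(* [beta (3 - beta^2) / 2] is the modulus of the derivative at the origin of
   the extremal function with parameter [beta]. *)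
Lemma extremal_parameter (a : R) :
  (0 <= a < 1)%R -> exists beta, (0 <= beta < 1)%R /\ (beta * (3 - beta ^ 2) / 2 = a)%R.
Proof.
intros Ha.
destruct (IVT_gen (fun x => x * (3 - x ^ 2) / 2)%R 0 1 a) as [x [Hx Ex]].
- intros x. apply derivable_continuous_pt. reg.
- split.
  + rewrite Rmin_left; lra.
  + rewrite Rmax_right; lra.
- rewrite Rmin_left, Rmax_right in Hx by lra.
  exists x. split; [|exact Ex]. split; [lra|].
  destruct (Req_dec x 1) as [->|]; lra.
Qed.

Lemma bloch_coeffs_1 (f : nat -> C) :
  bloch_coeffs f -> (Cmod (f 1%nat) ^ 2 <= 27 / 4 * (1 - Cmod (f O) ^ 2))%R.
Proof.
intros Hf. assert (Ha := bloch_coeffs_0 f Hf).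
assert (Hlin := bloch_coeffs_linear_norm f).
set (a := Cmod (f O)) in *. set (c := Cmod (f 1%nat)) in *.
assert (Ha0 : (0 <= a)%R) by apply Cmod_ge_0. assert (Hc0 : (0 <= c)%R) by apply Cmod_ge_0.
assert (H3 := sqrt3_sq). assert (H3' := sqrt3_bounds).
(* Shrinking by [tau < 1] excludes the degenerate parameter [beta = 1]. *)
assert (Htau : forall tau, (0 <= tau < 1)%R ->
  ((tau * c) ^ 2 <= 27 / 4 * (1 - (tau * a) ^ 2))%R).
{ intros tau Ht. destruct (extremal_parameter (tau * a)%R) as [beta [Hb Eb]]; [nra|].
  specialize (Hlin beta Hf Hb).
  assert (Hb2 : (0 <= beta ^ 2 < 1)%R) by nra.
  set (u := (beta ^ 2)%R) in *.
  (* Inserting [tau a = beta (3 - u) / 2] leaves [(1 + u) (3 - u)^2 / 2 - 2 u (2 - u) (3 - u)],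
     which is the right-hand side. *)
  assert (Hc : (sqrt 3 * (1 - u) * (tau * c) <= 3 / 2 * (3 - u) * (1 - u) ^ 2)%R).
  { assert (E : (4 * beta * (2 - u) * (tau * a) = 2 * u * (2 - u) * (3 - u))%R)
      by (rewrite <- Eb; unfold u; field).
    assert (0 <= (1 + u) * (3 - u) ^ 2 / 2)%R by nra.
    assert (tau * ((1 + u) * (3 - u) ^ 2 / 2) <= (1 + u) * (3 - u) ^ 2 / 2)%R by nra.
    assert (tau * (sqrt 3 * (1 - u) * c + 4 * beta * (2 - u) * a)
            <= tau * ((1 + u) * (3 - u) ^ 2 / 2))%R by (apply Rmult_le_compat_l; lra).
    nra. }
  assert (Hc' : (tau * c <= sqrt 3 / 2 * (3 - u) * (1 - u))%R).
  { apply Rmult_le_reg_l with (sqrt 3 * (1 - u))%R; [nra|].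
    eapply Rle_trans; [exact Hc|]. right.
    transitivity (sqrt 3 * sqrt 3 / 2 * (3 - u) * (1 - u) ^ 2)%R; [rewrite H3; ring|field]. }
  assert (Hsq : ((tau * c) ^ 2 <= 3 / 4 * ((3 - u) * (1 - u)) ^ 2)%R).
  { replace (3 / 4 * ((3 - u) * (1 - u)) ^ 2)%R
      with ((sqrt 3 / 2 * (3 - u) * (1 - u)) ^ 2)%R.
    - apply pow_incr. split; [nra|exact Hc'].
    - transitivity (sqrt 3 * sqrt 3 / 4 * ((3 - u) * (1 - u)) ^ 2)%R; [field|rewrite H3; field]. }
  replace ((tau * a) ^ 2)%R with (u * (3 - u) ^ 2 / 4)%R by (rewrite <- Eb; unfold u; field).
  assert (E : (27 / 4 * (1 - u * (3 - u) ^ 2 / 4) - 3 / 4 * ((3 - u) * (1 - u)) ^ 2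
    = 3 / 16 * (1 - u) ^ 2 * (u * (15 - 4 * u)))%R) by field.
  assert (0 <= 3 / 16 * (1 - u) ^ 2 * (u * (15 - 4 * u)))%R
    by (apply Rmult_le_pos; [apply Rmult_le_pos; [lra|apply pow2_ge_0]|nra]).
  lra. }
(* Now [tau^2 X <= 27/4] for all [tau < 1]. If [X > 27/4], the midpoint [tau] of [k = 27/4 / X] and
   1 contradicts this, as [((1 + k) / 2)^2 > k]. *)
set (X := (c ^ 2 + 27 / 4 * a ^ 2)%R).
assert (HX : (0 <= X)%R) by (unfold X; nra).
enough (X <= 27 / 4)%R by (unfold X in *; lra).
destruct (Rle_or_lt X (27 / 4)) as [|Hlt]; [assumption|].
assert (Hq : (0 < 27 / 4 / X < 1)%R)
  by (split; [apply Rdiv_lt_0_compat|apply Rlt_div_l]; lra).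
set (tau := ((1 + 27 / 4 / X) / 2)%R).
assert (Ht : (0 <= tau < 1)%R) by (unfold tau; lra).
assert (Htx : (27 / 4 / X < tau ^ 2)%R)
  by (unfold tau; set (k := (27 / 4 / X)%R) in *; nra).
specialize (Htau tau Ht).
assert (tau ^ 2 * X <= 27 / 4)%R by (unfold X; nra).
assert (27 / 4 < tau ^ 2 * X)%R by (apply (Rlt_div_l _ _ X); lra). lra.
Qed.

(** * Parseval's inequality *)

(** Orthogonality of powers: on the circle [Cconj (z ^ k) * z ^ i] is [Cconj (z ^ (k - i))], and
    [1 <= k - i <= n] excludes wrapping around. *)
Lemma mean_conj_pow_mult_psum (a : nat -> C) (m k n : nat) :
  (m < k <= n)%nat -> mean n (fun z => Cconj (z ^ k) * psum a m z) = 0.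
Proof.
assert (Hterm : forall i, (i < k <= n)%nat -> mean n (fun z => Cconj (z ^ k) * z ^ i) = 0).
{ intros i Hi. rewrite (mean_ext _ _ (fun z => Cconj (z ^ (k - i)))).
  - rewrite mean_conj, mean_pow by lia. unfold Cconj, RtoC; simpl. now rewrite Ropp_0.
  - intros z Hz. replace (z ^ k) with (z ^ (k - i) * z ^ i)
      by (rewrite <- Cpow_add_r; f_equal; lia).
    rewrite Cmult_conj, <- Cmult_assoc, Cmult_conj_circle, Cmult_1_r; [reflexivity|].
    now rewrite Cmod_pow, Hz, pow1. }
induction m as [|m IH]; intros Hk.
- rewrite (mean_ext _ _ (fun z => a O * (Cconj (z ^ k) * z ^ 0))).
  + rewrite mean_scal, Hterm by lia. ring.
  + intros. unfold psum, csum, Csum. ring.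
- rewrite (mean_ext _ _ (fun z => Cconj (z ^ k) * psum a m z +
    a (S m) * (Cconj (z ^ k) * z ^ S m))) by (intros; rewrite psum_S; ring).
  rewrite mean_plus, mean_scal, Hterm, IH by lia. ring.
Qed.

Lemma parseval_psum (a : nat -> C) (m n : nat) : (m <= n)%nat ->
  mean n (fun z => psum a m z * Cconj (psum a m z)) =
  RtoC (sum_f_R0 (fun k => Cmod (a k) ^ 2)%R m).
Proof.
induction m as [|m IH]; intros Hm.
- rewrite (mean_ext _ _ (fun _ => a O * Cconj (a O))).
  + rewrite mean_const, <- Cmod2_conj. reflexivity.
  + intros. unfold psum, csum, Csum. simpl. now rewrite Cmult_1_r.
(* Expansion of the squared modulus with the top term split off; the two cross terms are conjugate
   and have mean 0. *)
- rewrite (mean_ext _ _ (fun z => (psum a m z * Cconj (psum a m z) +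
    a (S m) * Cconj (a (S m))) +
    (Cconj (a (S m)) * (Cconj (z ^ S m) * psum a m z) +
     a (S m) * Cconj (Cconj (z ^ S m) * psum a m z)))).
  + rewrite !mean_plus, !mean_scal, mean_const, IH by lia.
    rewrite (mean_conj n (fun z => Cconj (z ^ S m) * psum a m z)).
    rewrite mean_conj_pow_mult_psum by lia.
    rewrite <- Cmod2_conj, tech5, RtoC_plus.
    replace (Cconj 0) with (RtoC 0) by (unfold Cconj, RtoC; simpl; now rewrite Ropp_0).
    ring.
  + intros z Hz. rewrite psum_S, Cplus_conj, !Cmult_conj, Cconj_conj.
    assert (E : z ^ S m * Cconj (z ^ S m) = 1).
    { rewrite Cmult_comm. apply Cmult_conj_circle. now rewrite Cmod_pow, Hz, pow1. }
    transitivity (psum a m z * Cconj (psum a m z) + a (S m) * Cconj (a (S m)) *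
      (z ^ S m * Cconj (z ^ S m)) + (Cconj (a (S m)) * (Cconj (z ^ S m) * psum a m z) +
     a (S m) * (z ^ S m * Cconj (psum a m z)))); [ring|].
    rewrite E. ring.
Qed.

Lemma sum_Cmod_sq_le (a : nat -> C) (m : nat) (M : R) :
  (forall z, Cmod z = 1%R -> (Cmod (psum a m z) <= M)%R) ->
  (sum_f_R0 (fun k => Cmod (a k) ^ 2)%R m <= M ^ 2)%R.
Proof.
intros H. assert (Hle := mean_le m (fun z => psum a m z * Cconj (psum a m z))
  (fun _ => RtoC (M ^ 2))).
rewrite parseval_psum, mean_const, re_RtoC, Cmod_R in Hle by lia.
eapply Rle_trans; [apply Rle_abs|]. apply Hle.
intros z Hz. specialize (H z Hz). assert (H0 := Cmod_ge_0 (psum a m z)).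
rewrite Cmod_mult, Cmod_conj. nra.
Qed.

Lemma sum_f_R0_le_extend (u : nat -> R) (n m : nat) :
  (forall k, (0 <= u k)%R) -> (n <= m)%nat -> (sum_f_R0 u n <= sum_f_R0 u m)%R.
Proof.
intros Hu Hnm. induction Hnm as [|m Hnm IH]; [lra|].
simpl. specialize (Hu (S m)). lra.
Qed.

(** For [|z|^2 = 1/3] the growth bound is [1 / (1 - 1/3) = 3/2]; Parseval yields its square. *)
Lemma bloch_coeffs_sum_third (f : nat -> C) (n : nat) :
  bloch_coeffs f -> (sum_f_R0 (fun k => Cmod (f k) ^ 2 * (1 / 3) ^ k)%R n <= 9 / 4)%R.
Proof.
intros Hf. set (rho := sqrt (1 / 3)).
assert (Hrho : (rho * rho = 1 / 3)%R) by (apply sqrt_sqrt; lra).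
assert (Hrho0 : (0 <= rho)%R) by apply sqrt_pos.
apply le_epsilon; intros eps He.
(* Since [e <= 1], [9/4 (1 + e)^2 <= 9/4 + 27/4 e], which is at most [9/4 + eps]. *)
set (e := Rmin 1 (eps / 9)).
assert (Hee : (0 < e)%R) by (apply Rmin_glb_lt; lra).
assert (He1 : (e <= 1)%R) by apply Rmin_l.
assert (He2 : (e <= eps / 9)%R) by apply Rmin_r.
destruct (Hf rho e) as [N HN]; [nra|assumption|].
set (m := (n + N)%nat). specialize (HN m ltac:(lia)).
apply Rle_trans with (sum_f_R0 (fun k => Cmod (f k) ^ 2 * (1 / 3) ^ k)%R m).
{ apply sum_f_R0_le_extend; [|lia]. intros k.
  apply Rmult_le_pos; [apply pow2_ge_0|apply pow_le; lra]. }
assert (H := sum_Cmod_sq_le (fun k => f k * RtoC rho ^ k) m (3 / 2 * (1 + e))%R).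
rewrite (sum_eq _ (fun k => Cmod (f k) ^ 2 * (1 / 3) ^ k)%R) in H.
- apply Rle_trans with ((3 / 2 * (1 + e)) ^ 2)%R; [|nra].
  apply H. intros z Hz.
  replace (psum (fun k => f k * RtoC rho ^ k) m z) with (psum f m (RtoC rho * z)).
  + specialize (HN (RtoC rho * z)).
    rewrite Cmod_mult, Hz, Rmult_1_r, Cmod_R, Rabs_pos_eq in HN by assumption.
    specialize (HN (Rle_refl _)). nra.
  + unfold psum. apply csum_ext. intros k _. rewrite Cpow_mult_l. ring.
- intros k _. rewrite Cmod_mult, Cmod_pow, Cmod_R, Rabs_pos_eq by assumption.
  rewrite Rpow_mult_distr, <- Hrho. f_equal. rewrite Rpow_mult_distr. simpl. ring.
Qed.

(* For [k >= 2], [x^k <= (3 x)^2 (1/3)^k]. *)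
Lemma sum_two_terms_le (c : nat -> R) (x : R) (n : nat) :
  (forall k, (0 <= c k)%R) -> (0 <= x <= 1 / 3)%R ->
  (sum_f_R0 (fun k => c k * x ^ k)%R (S n) <=
   9 * x ^ 2 * sum_f_R0 (fun k => c k * (1 / 3) ^ k)%R (S n)
   + c O * (1 - 9 * x ^ 2) + c 1%nat * (x - 3 * x ^ 2))%R.
Proof.
intros Hc Hx. induction n as [|n IH].
- simpl. right. field.
- rewrite !(tech5 _ (S n)).
  enough (c (S (S n)) * x ^ S (S n) <= 9 * x ^ 2 * (c (S (S n)) * (1 / 3) ^ S (S n)))%R by nra.
  assert (Hp : (x ^ n <= (1 / 3) ^ n)%R) by (apply pow_incr; lra).
  specialize (Hc (S (S n))).
  replace (9 * x ^ 2 * (c (S (S n)) * (1 / 3) ^ S (S n)))%R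
    with (c (S (S n)) * (x ^ 2 * (1 / 3) ^ n))%R by (simpl; field).
  apply Rmult_le_compat_l; [assumption|].
  replace (x ^ S (S n))%R with (x ^ 2 * x ^ n)%R by (simpl; ring).
  apply Rmult_le_compat_l; [apply pow2_ge_0|assumption].
Qed.

(** The claim divided by [x = r^2]: the term [k^2 |b_k|^2 r^(2k)] is [x] times the one of index
    [k - 1] here. *)
Lemma bloch_coeffs_sum (f : nat -> C) (x : R) (n : nat) :
  bloch_coeffs f -> (4 / 15 <= x <= 1 / 3)%R ->
  (sum_f_R0 (fun k => Cmod (f k) ^ 2 * x ^ k)%R n <= 27 / 4 * x)%R.
Proof.
intros Hf Hx.
assert (Hc : forall k, (0 <= Cmod (f k) ^ 2)%R) by (intros; apply pow2_ge_0).
eapply Rle_trans; [apply (sum_f_R0_le_extend _ n (S n)); [|lia]|].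
{ intros k. apply Rmult_le_pos; [apply Hc|apply pow_le; lra]. }
eapply Rle_trans; [apply (sum_two_terms_le (fun k => Cmod (f k) ^ 2)%R); [exact Hc|lra]|].
assert (H1 := bloch_coeffs_1 f Hf). assert (H2 := bloch_coeffs_sum_third f (S n) Hf).
assert (H3 := Hc O).
set (A := (Cmod (f O) ^ 2)%R) in *. set (c := (Cmod (f 1%nat) ^ 2)%R) in *.
set (T := sum_f_R0 _ (S n)) in *.
assert (HA : (A <= 1)%R).
{ unfold A. assert (H := bloch_coeffs_0 f Hf). assert (H' := Cmod_ge_0 (f O)). nra. }
assert (9 * x ^ 2 * T <= 9 * x ^ 2 * (9 / 4))%R by (apply Rmult_le_compat_l; nra).
assert (c * (x - 3 * x ^ 2) <= 27 / 4 * (1 - A) * (x - 3 * x ^ 2))%R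
  by (apply Rmult_le_compat_r; nra).
assert (E : (27 / 4 * x - (9 * x ^ 2 * (9 / 4) + A * (1 - 9 * x ^ 2)
    + 27 / 4 * (1 - A) * (x - 3 * x ^ 2))
  = A * (1 - 3 * x) * (15 / 4 * x - 1))%R) by field.
assert (0 <= A * (1 - 3 * x) * (15 / 4 * x - 1))%R by (apply Rmult_le_pos; nra).
lra.
Qed.

(** * From the class B to Taylor polynomials *)

Lemma Un_cv_diff_0 (u : nat -> R) (l : R) :
  Un_cv u l -> forall eps, (0 < eps)%R ->
  exists N, forall n, (N <= n)%nat -> (Rabs (u (S n) - u n) < eps)%R.
Proof.
intros H eps He. destruct (H (eps / 2)%R) as [N HN]; [lra|].
exists N. intros n Hn. assert (H1 := HN n Hn). assert (H2 := HN (S n) ltac:(lia)).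
unfold Rdist in *. apply Rabs_def1; apply Rabs_def2 in H1; apply Rabs_def2 in H2; lra.
Qed.

Lemma eventually_bounded (u : nat -> R) (N : nat) (M : R) :
  (forall n, (N <= n)%nat -> (u n <= M)%R) -> exists B, forall n, (u n <= B)%R.
Proof.
revert M. induction N as [|N IH]; intros M H.
- exists M. intros; apply H; lia.
- apply (IH (Rmax M (u N))). intros n Hn.
  destruct (Nat.eq_dec n N) as [->|]; [apply Rmax_r|].
  eapply Rle_trans; [apply H; lia|apply Rmax_l].
Qed.

Lemma Cmod_le_abs (z : C) : (Cmod z <= Rabs (fst z) + Rabs (snd z))%R.
Proof.
unfold Cmod. assert (H1 := Rabs_pos (fst z)). assert (H2 := Rabs_pos (snd z)).
rewrite <- (sqrt_pow2 (Rabs (fst z) + Rabs (snd z))) by lra.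
apply sqrt_le_1_alt. rewrite <- (pow2_abs (fst z)), <- (pow2_abs (snd z)). nra.
Qed.

Lemma series_cv_terms_bounded (a : nat -> C) (l : C) :
  Cseries_cv a l -> exists B, forall n, (Cmod (a n) <= B)%R.
Proof.
intros [H1 H2].
destruct (Un_cv_diff_0 _ _ H1 1%R) as [N1 HN1]; [lra|].
destruct (Un_cv_diff_0 _ _ H2 1%R) as [N2 HN2]; [lra|].
apply (eventually_bounded _ (S (N1 + N2)) 2). intros [|n] Hn; [lia|].
specialize (HN1 n ltac:(lia)). specialize (HN2 n ltac:(lia)).
simpl in HN1, HN2.
replace (fst (Csum a n) + fst (a (S n)) - fst (Csum a n))%R with (fst (a (S n))) in HN1 by ring.
replace (snd (Csum a n) + snd (a (S n)) - snd (Csum a n))%R with (snd (a (S n))) in HN2 by ring.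
eapply Rle_trans; [apply Cmod_le_abs|lra].
Qed.

Lemma series_cv_Cmod (a : nat -> C) (l : C) (eps : R) :
  Cseries_cv a l -> (0 < eps)%R ->
  exists N, forall n, (N <= n)%nat -> (Cmod (csum a n - l)%C <= eps)%R.
Proof.
intros [H1 H2] He.
destruct (H1 (eps / 2)%R) as [N1 HN1]; [lra|].
destruct (H2 (eps / 2)%R) as [N2 HN2]; [lra|].
exists (N1 + N2)%nat. intros n Hn.
specialize (HN1 n ltac:(lia)). specialize (HN2 n ltac:(lia)). unfold Rdist in *.
eapply Rle_trans; [apply Cmod_le_abs|].
change (Rabs (fst (Csum a n) - fst l) + Rabs (snd (Csum a n) - snd l) <= eps)%R. lra.
Qed.

Lemma Cmod_csum_tail (a : nat -> C) (M q : R) (n p : nat) :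
  (0 <= q < 1)%R -> (0 <= M)%R -> (forall k, (Cmod (a k) <= M * q ^ k)%R) ->
  (Cmod (csum a (n + p) - csum a n)%C <= M * q ^ n / (1 - q))%R.
Proof.
intros Hq HM Ha.
(* Keeping the subtracted [M * q ^ (n + p)] makes the bound pass through induction on [p]. *)
apply Rle_trans with ((M * q ^ n - M * q ^ (n + p)) / (1 - q))%R.
- induction p as [|p IH].
  + rewrite Nat.add_0_r. replace (csum a n - csum a n) with (RtoC 0) by ring.
    rewrite Cmod_0. right. field. lra.
  + rewrite Nat.add_succ_r, csum_S.
    replace (csum a (n + p) + a (S (n + p)) - csum a n)
      with ((csum a (n + p) - csum a n) + a (S (n + p))) by ring.
    eapply Rle_trans; [apply Cmod_triangle|].
    specialize (Ha (S (n + p))). simpl pow in *.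
    assert (Hpw : (0 <= q ^ (n + p))%R) by (apply pow_le; lra).
    replace ((M * q ^ n - M * (q * q ^ (n + p))) / (1 - q))%R
      with ((M * q ^ n - M * q ^ (n + p)) / (1 - q) + M * q ^ (n + p))%R by (field; lra).
    assert (0 <= M * q ^ (n + p))%R by (apply Rmult_le_pos; lra). nra.
- apply Rmult_le_compat_r; [apply Rlt_le, Rinv_0_lt_compat; lra|].
  assert (0 <= M * q ^ (n + p))%R by (apply Rmult_le_pos; [|apply pow_le]; lra). lra.
Qed.

Definition deriv_coeffs (b : nat -> C) (k : nat) : C := RtoC (INR (S k)) * b (S k).

Lemma Defs_Cpow (z : C) (n : nat) : Defs.Cpow z n = z ^ n.
Proof. induction n as [|n IH]; [reflexivity|]. simpl. now rewrite IH. Qed.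

Lemma deriv_terms_eq (b : nat -> C) (z : C) (k : nat) :
  deriv_terms b z k = deriv_coeffs b k * z ^ k.
Proof.
unfold deriv_terms, deriv_coeffs. rewrite Defs_Cpow.
change (RtoC (INR (S k)) * (b (S k) * z ^ k) = RtoC (INR (S k)) * b (S k) * z ^ k). ring.
Qed.

(** Convergence at a radius [R1] beyond [rho] bounds the terms there, so for [|z| <= rho] they decay
    geometrically at a rate independent of [z], and the Taylor polynomials converge uniformly. *)
Lemma classB_bloch_coeffs (b : nat -> C) : in_classB b -> bloch_coeffs (deriv_coeffs b).
Proof.
intros [_ HB] rho eps Hr He.
(* [rho] may be negative. *)
set (r := Rmax 0 rho).
assert (Hr1 : (0 <= r)%R) by apply Rmax_l. assert (Hr2 : (rho <= r)%R) by apply Rmax_r.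
assert (Hr3 : (r < 1)%R) by (apply Rmax_lub_lt; lra).
set (R1 := ((1 + r) / 2)%R). assert (HR1 : (r < R1 < 1)%R) by (unfold R1; lra).
destruct (HB (RtoC R1)) as [d [Hd _]].
{ change (Cmod R1 < 1)%R. rewrite Cmod_R, Rabs_pos_eq; lra. }
destruct (series_cv_terms_bounded _ _ Hd) as [M HM].
assert (HM0 : (0 <= M)%R) by (eapply Rle_trans; [apply Cmod_ge_0|apply (HM O)]).
set (q := (r / R1)%R).
assert (Hq : (0 <= q < 1)%R).
{ unfold q; split; [apply Rdiv_le_0_compat; lra|apply Rlt_div_l; lra]. }
assert (Hcoef : forall z, (Cmod z <= rho)%R -> forall k, (Cmod (deriv_terms b z k) <= M * q ^ k)%R).
{ intros z Hz k. specialize (HM k). rewrite deriv_terms_eq, Cmod_mult, Cmod_pow in *.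
  rewrite Cmod_R, Rabs_pos_eq in HM by lra.
  apply Rle_trans with (Cmod (deriv_coeffs b k) * r ^ k)%R.
  - apply Rmult_le_compat_l; [apply Cmod_ge_0|]. apply pow_incr. split; [apply Cmod_ge_0|lra].
  - replace r with (R1 * q)%R at 1 by (unfold q; field; lra).
    rewrite Rpow_mult_distr, <- Rmult_assoc.
    apply Rmult_le_compat_r; [apply pow_le; lra|assumption]. }
assert (Hpow : exists N, (M * q ^ N / (1 - q) <= eps / 2)%R).
{ destruct (pow_lt_1_zero q) with (y := (eps / 2 * (1 - q) / (1 + M))%R) as [J HJ].
  - rewrite Rabs_pos_eq; lra.
  - apply Rdiv_lt_0_compat; nra.
  - exists J. specialize (HJ J (le_n J)).
    assert (HqJ : (0 <= q ^ J)%R) by (apply pow_le; lra).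
    rewrite Rabs_pos_eq in HJ by assumption.
    apply Rle_div_l; [lra|]. apply Rlt_div_r in HJ; nra. }
destruct Hpow as [N HN]. exists N. intros n Hn z Hz.
assert (Hz0 := Cmod_ge_0 z).
destruct (HB z) as [w [Hw Hwb]]; [change (Cmod z < 1)%R; lra|].
change (Cmod w <= 1 / (1 - Cmod z ^ 2))%R in Hwb.
(* [N'] depends on [z], but it only serves to compare with the limit through the partial sum up to
   [n + N']; [N] was chosen uniformly. *)
destruct (series_cv_Cmod _ _ (eps / 2)%R Hw) as [N' HN']; [lra|].
specialize (HN' (n + N')%nat ltac:(lia)).
assert (Htail := Cmod_csum_tail (deriv_terms b z) M q n N' Hq HM0 (Hcoef z Hz)).
assert (HNn : (M * q ^ n / (1 - q) <= M * q ^ N / (1 - q))%R).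
{ apply Rmult_le_compat_r; [apply Rlt_le, Rinv_0_lt_compat; lra|].
  apply Rmult_le_compat_l; [assumption|].
  replace n with (N + (n - N))%nat by lia. rewrite pow_add.
  assert (0 <= q ^ N)%R by (apply pow_le; lra).
  assert (q ^ (n - N) <= 1)%R by (rewrite <- (pow1 (n - N)); apply pow_incr; lra). nra. }
replace (psum (deriv_coeffs b) n z) with (csum (deriv_terms b z) n)
  by (unfold psum; apply csum_ext; intros; apply deriv_terms_eq).
set (P := csum (deriv_terms b z) n) in *. set (Q := csum (deriv_terms b z) (n + N')) in *.
assert (HP : (Cmod P <= Cmod w + eps)%R).
{ assert (T1 := Cmod_triangle (w + (Q - w)) (- (Q - P))).
  assert (T2 := Cmod_triangle w (Q - w)). rewrite Cmod_opp in T1.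
  replace (w + (Q - w) + - (Q - P)) with P in T1 by ring. lra. }
assert (Hz1 : (0 < 1 - Cmod z ^ 2 <= 1)%R) by nra.
apply Rle_div_r in Hwb; [|lra]. nra.
Qed.

Lemma sum_sq_terms (b : nat -> C) (r : R) (n : nat) :
  sum_f_R0 (sq_terms b r) (S n) =
  (r ^ 2 * sum_f_R0 (fun k => Cmod (deriv_coeffs b k) ^ 2 * (r ^ 2) ^ k) n)%R.
Proof.
assert (E : forall k, sq_terms b r (S k) =
  (r ^ 2 * (Cmod (deriv_coeffs b k) ^ 2 * (r ^ 2) ^ k))%R).
{ intros k. unfold sq_terms, deriv_coeffs. rewrite Cmod_mult, Cmod_R, Rabs_pos_eq
    by apply pos_INR.
  change (Cnorm (b (S k))) with (Cmod (b (S k))).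
  rewrite pow_mult. change ((r ^ 2) ^ S k)%R with (r ^ 2 * (r ^ 2) ^ k)%R.
  generalize ((r ^ 2) ^ k)%R. intros p. ring. }
rewrite decomp_sum by lia. simpl pred. rewrite scal_sum.
replace (sq_terms b r 0) with 0%R by (unfold sq_terms; simpl; ring).
rewrite Rplus_0_l. apply sum_eq. intros k _. rewrite E. ring.
Qed.

Lemma nonneg_series_cv (u : nat -> R) (M : R) :
  (forall k, (0 <= u k)%R) -> (forall n, (sum_f_R0 u n <= M)%R) ->
  exists l, infinite_sum u l /\ (l <= M)%R.
Proof.
intros Hu HM.
destruct (growing_cv (sum_f_R0 u)) as [l Hl].
- intros n. simpl. specialize (Hu (S n)). lra.
- exists M. intros x [n ->]. apply HM.
- exists l. split; [exact Hl|].
  apply (Rle_cv_lim HM Hl). intros eps He. exists 0%nat. intros.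
  rewrite Rdist_eq. exact He.
Qed.

Lemma sqrt_bounds_sq (r : R) :
  (sqrt (4 / 15) <= r <= sqrt (1 / 3))%R -> (4 / 15 <= r ^ 2 <= 1 / 3)%R.
Proof.
intros [H1 H2]. assert (E1 : (sqrt (4 / 15) * sqrt (4 / 15) = 4 / 15)%R) by (apply sqrt_sqrt; lra).
assert (E2 : (sqrt (1 / 3) * sqrt (1 / 3) = 1 / 3)%R) by (apply sqrt_sqrt; lra).
assert (H0 := sqrt_pos (4 / 15)). nra.
Qed.

Lemma classB_sum_sq_terms (b : nat -> C) (r : R) (n : nat) :
  in_classB b -> (sqrt (4 / 15) <= r <= sqrt (1 / 3))%R ->
  (sum_f_R0 (sq_terms b r) n <= 27 / 4 * r ^ 4)%R.
Proof.
intros Hb Hr. apply sqrt_bounds_sq in Hr.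
eapply Rle_trans; [apply (sum_f_R0_le_extend _ n (S n)); [|lia]|].
{ intros k. unfold sq_terms. rewrite pow_mult.
  apply Rmult_le_pos; [apply Rmult_le_pos; apply pow2_ge_0|apply pow_le, pow2_ge_0]. }
rewrite sum_sq_terms.
assert (H := bloch_coeffs_sum _ (r ^ 2)%R n (classB_bloch_coeffs b Hb) Hr).
replace (27 / 4 * r ^ 4)%R with (r ^ 2 * (27 / 4 * r ^ 2))%R by field.
apply Rmult_le_compat_l; [apply pow2_ge_0|exact H].
Qed.

(** * The extremal function *)

Lemma Cseries_cv_eventually (a : nat -> C) (l : C) (N : nat) :
  (forall n, (N <= n)%nat -> csum a n = l) -> Cseries_cv a l.
Proof.
intros H; split; intros eps He; exists N; intros n Hn;
  change (Csum a n) with (csum a n); rewrite H by lia; rewrite Rdist_eq; exact He.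
Qed.

Lemma csum_const_tail (a : nat -> C) (N n : nat) :
  (forall k, (N < k)%nat -> a k = 0) -> (N <= n)%nat -> csum a n = csum a N.
Proof.
intros Ha Hn. induction Hn as [|n Hn IH]; [reflexivity|].
rewrite csum_S, IH, Ha by lia. ring.
Qed.

Lemma extremal_deriv_bound (x : R) :
  (0 <= x < 1)%R -> (3 * sqrt 3 / 2 * x <= 1 / (1 - x ^ 2))%R.
Proof.
intros Hx. apply (Rle_div_r _ _ (1 - x ^ 2)); [nra|].
assert (Hs := sqrt3_sq). assert (Hs' := sqrt3_bounds).
(* With [y = sqrt 3 x], [2 - y (3 - y^2) = (1 - y)^2 (2 + y)]. *)
set (y := (sqrt 3 * x)%R). assert (Hy : (0 <= y)%R) by (unfold y; nra).
assert (Hy2 : (y ^ 2 = 3 * x ^ 2)%R)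
  by (transitivity (sqrt 3 * sqrt 3 * x ^ 2)%R; [unfold y; ring|rewrite Hs; ring]).
replace (3 * sqrt 3 / 2 * x * (1 - x ^ 2))%R with (y * (3 - 3 * x ^ 2) / 2)%R
  by (unfold y; field).
rewrite <- Hy2.
assert (0 <= (1 - y) ^ 2 * (2 + y))%R by (apply Rmult_le_pos; [apply pow2_ge_0|lra]).
lra.
Qed.

Lemma extremal_in_classB : in_classB b_extremal.
Proof.
split.
- intros z _. exists (csum (fun k => Cmul (b_extremal k) (Defs.Cpow z k)) 2).
  apply (Cseries_cv_eventually _ _ 2).
  intros n Hn. apply csum_const_tail; [|assumption].
  intros [|[|[|k]]] Hk; try lia. change (0 * Defs.Cpow z (S (S (S k))) = 0). ring.
- intros z Hz. change (Cmod z < 1)%R in Hz.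
  exists (RtoC (3 * sqrt 3 / 2) * z). split.
  + apply (Cseries_cv_eventually _ _ 1). intros n Hn.
    rewrite (csum_const_tail _ 1) by
      (try assumption; intros [|[|k]] Hk; try lia; rewrite deriv_terms_eq;
       unfold deriv_coeffs; change (b_extremal (S (S (S k)))) with (RtoC 0); ring).
    rewrite csum_S. change (csum (deriv_terms b_extremal z) 0) with (deriv_terms b_extremal z 0).
    rewrite !deriv_terms_eq. unfold deriv_coeffs.
    change (b_extremal 1) with (RtoC 0). change (b_extremal 2) with (RtoC (3 * sqrt 3 / 4)).
    replace (3 * sqrt 3 / 2)%R with (INR 2 * (3 * sqrt 3 / 4))%R by (simpl; field).
    rewrite RtoC_mult, Cpow_1_r. ring.
  + change (Cmod (RtoC (3 * sqrt 3 / 2) * z) <= 1 / (1 - Cmod z ^ 2))%R.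
    assert (Hs := sqrt_pos 3).
    rewrite Cmod_mult, Cmod_R, Rabs_pos_eq by lra.
    apply extremal_deriv_bound. split; [apply Cmod_ge_0|exact Hz].
Qed.

Lemma extremal_sum (r : R) : infinite_sum (sq_terms b_extremal r) (27 / 4 * r ^ 4)%R.
Proof.
intros eps He. exists 2%nat. intros n Hn.
replace (sum_f_R0 (sq_terms b_extremal r) n) with (27 / 4 * r ^ 4)%R.
- rewrite Rdist_eq. exact He.
- induction Hn as [|n Hn IH].
  + unfold sum_f_R0, sq_terms.
    change (Cnorm (b_extremal 2)) with (Cmod (RtoC (3 * sqrt 3 / 4))).
    change (Cnorm (b_extremal 1)) with (Cmod 0).
    assert (Hs := sqrt_pos 3).
    rewrite Cmod_0, Cmod_R, Rabs_pos_eq by lra.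
    (* The term of index 2 is [2^2 (27/16) r^4]; the others vanish. *)
    replace ((3 * sqrt 3 / 4) ^ 2)%R with (27 / 16)%R; [simpl; field|].
    transitivity (9 / 16 * (sqrt 3 * sqrt 3))%R; [rewrite sqrt3_sq|]; field.
  + rewrite tech5, <- IH. unfold sq_terms.
    destruct n as [|[|n]]; [lia|lia|].
    change (Cnorm (b_extremal (S (S (S n))))) with (Cmod 0). rewrite Cmod_0. ring.
Qed.

Open Scope R_scope.

Theorem theorem2 :
  (forall (b : nat -> Cplx), in_classB b ->
     forall r : R, sqrt (4 / 15) <= r <= sqrt (1 / 3) ->
       exists l : R, infinite_sum (sq_terms b r) l /\ l <= 27 / 4 * r ^ 4)
  /\
  (in_classB b_extremal /\
   forall r : R, sqrt (4 / 15) <= r <= sqrt (1 / 3) ->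
     infinite_sum (sq_terms b_extremal r) (27 / 4 * r ^ 4)).
Proof.
split; [|split].
- intros b Hb r Hr. apply nonneg_series_cv.
  + intros k. unfold sq_terms. rewrite pow_mult.
    apply Rmult_le_pos; [apply Rmult_le_pos; apply pow2_ge_0|apply pow_le, pow2_ge_0].
  + intros n. now apply classB_sum_sq_terms.
- exact extremal_in_classB.
- intros r _. apply extremal_sum.
Qed.
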